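(* Let $n\in\mathbb{N}$ and let $1\neq m\in\mathbb{Z}_n$ be a unit. Let $M=\mathcal{F}_nP_{(\cdot m)}$, and let $t_\lambda$ denote the multiplicity of the eigenvalue $\lambda$ for $M$. Then $\operatorname{tr}(M)$ and the multiplicities $t_1,t_{-1},t_i,t_{-i}$ are given by the following list. \begin{itemize} \item $n=4k$, $m=4l+1$, $\left(\frac{n}{m}\right)=1$: $\operatorname{tr}(M)=1+i$ and $(t_1,t_{-1},t_i,t_{-i})=(k+1,k,k,k-1)$. \item $n=4k$, $m=4l+1$, $\left(\frac{n}{m}\right)=-1$: $\operatorname{tr}(M)=-1-i$ and $(t_1,t_{-1},t_i,t_{-i})=(k,k+1,k-1,k)$. \item $n=4k$, $m=4l+3$, $\left(\frac{n}{m}\right)=1$: $\operatorname{tr}(M)=1-i$ and $(t_1,t_{-1},t_i,t_{-i})=(k+1,k,k-1,k)$. \item $n=4k$, $m=4l+3$, $\left(\frac{n}{m}\right)=-1$: $\operatorname{tr}(M)=-1+i$ and $(t_1,t_{-1},t_i,t_{-i})=(k,k+1,k,k-1)$. \item $n=4k+1$, $\left(\frac{m}{n}\right)=1$: $\operatorname{tr}(M)=1$ and $(t_1,t_{-1},t_i,t_{-i})=(k+1,k,k,k)$. \item $n=4k+1$, $\left(\frac{m}{n}\right)=-1$: $\operatorname{tr}(M)=-1$ and $(t_1,t_{-1},t_i,t_{-i})=(k,k+1,k,k)$. \item $n=4k+2$: $\operatorname{tr}(M)=0$ and $(t_1,t_{-1},t_i,t_{-i})=(k+1,k+1,k,k)$.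 \item $n=4k+3$, $\left(\frac{m}{n}\right)=1$: $\operatorname{tr}(M)=i$ and $(t_1,t_{-1},t_i,t_{-i})=(k+1,k+1,k+1,k)$. \item $n=4k+3$, $\left(\frac{m}{n}\right)=-1$: $\operatorname{tr}(M)=-i$ and $(t_1,t_{-1},t_i,t_{-i})=(k+1,k+1,k,k+1)$. \end{itemize}
   Context: For an integer $n\ge 2$, $\mathcal{F}_n=\frac{1}{\sqrt n}\left(e^{2\pi i jk/n}\right)_{j,k}$ is the Fourier matrix, with rows and columns indexed by $\{0,1,\dots,n-1\}=\mathbb{Z}_n$. For a permutation $\sigma$ of $\{0,\dots,n-1\}$, $P_\sigma$ is the permutation matrix with $P_\sigma[j,k]=1$ if $j=\sigma(k)$ and $0$ otherwise; thus $(XP_\sigma)[j,k]=X[j,\sigma(k)]$. For a unit $m\in\mathbb{Z}_n$, $P_{(\cdot m)}$ is $P_\sigma$ for the permutation $\sigma(j)=mj \bmod n$. In the list, $m$ is represented by an integer in $\{1,\dots,n-1\}$, and $\left(\frac{a}{b}\right)$ denotes the Jacobi symbol. *)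

(* Defs.v *)
From HB Require Import structures.
From mathcomp Require Import all_boot all_order all_fingroup all_algebra.
From mathcomp Require Import reals trigo.
From mathcomp Require Import complex.

Set Implicit Arguments.
Unset Strict Implicit.
Unset Printing Implicit Defensive.

Import Order.TTheory GRing.Theory Num.Theory.
Local Open Scope ring_scope.
Local Open Scope complex_scope.

Definition cis (R : realType) (x : R) : R[i] := cos x +i* sin x.

(* The index type 'Z_n, i.e. 'I_((Zp_trunc n).+2), has n elements only when
   1 < n. *)
Definition fourier_mx (R : realType) (n : nat) : 'M[R[i]]_((Zp_trunc n).+2) :=
  \matrix_(j, k)
    ((Num.sqrt n%:R)^-1%:C * cis (2 * pi * (j * k)%N%:R / n%:R)).

(* perm_mx s has entry 1 at (j, k) when s j = k; the convention needed here is
   1 at (j, k) when j = s k, hence the transpose. *)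
Definition permutation_mx (R : realType) (n : nat) (s : {perm 'I_n}) :
    'M[R[i]]_n :=
  (perm_mx s)^T.

Definition mulZ_perm (n : nat) (m : {unit 'Z_n}) : {perm 'Z_n} :=
  perm (mulrI (valP m)).

Definition fourier_mul_mx (R : realType) (n : nat) (m : {unit 'Z_n}) :
    'M[R[i]]_((Zp_trunc n).+2) :=
  fourier_mx R n *m permutation_mx R (mulZ_perm m).

(* Algebraic multiplicity. *)
Definition eigen_mult (F : fieldType) (n : nat) (A : 'M[F]_n) (a : F) : nat :=
  mup a (char_poly A).

(* (t_1, t_{-1}, t_i, t_{-i}) *)
Definition eigen_mults (R : realType) (n : nat) (A : 'M[R[i]]_n) :
    nat * nat * nat * nat :=
  (eigen_mult A 1, eigen_mult A (- 1),
   eigen_mult A 'i%C, eigen_mult A (- 'i%C)).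

(* Meant for a prime p. *)
Definition legendre (a p : nat) : int :=
  if (p %| a)%N then 0
  else if [exists x : 'I_p, (x ^ 2 == a %[mod p])%N] then 1 else - 1.

(* Meant for odd b; jacobi a 1 = 1. *)
Definition jacobi (a b : nat) : int :=
  \prod_(p <- primes b) legendre a p ^+ logn p b.

(* Main.v *)
Require Import Defs.
From HB Require Import structures.
From mathcomp Require Import all_boot all_order all_fingroup all_algebra.
From mathcomp Require Import cyclic finfield algC cyclotomic.
From mathcomp Require Import reals trigo.
From mathcomp Require Import complex.
From mathcomp Require Import zify ring lra.

(** Since [M ^+ 2] is the permutation matrix of [j |-> - j], [M ^+ 4 = 1], so
    the multiplicities are determined by [n], [\tr (M ^+ 2)] (which is 1 or 2)
    and [\tr M], and [sqrt n * \tr M] is the quadratic Gauss sum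
    [G(m; n) = \sum_(j < n) e(m j^2 / n)].

    Its sign comes from Gauss' identity
    [\sum_(j < n) t ^+ (j ^ 2) = \prod_(0 < i < n) (1 + (- t) ^- i)], valid when
    [t ^+ 2] is a primitive n-th root of unity.  For [n = 2K] and [t = e(1/4K)]
    every factor has an explicit argument, whence
    [G(1; 4K) = (1 + i) sqrt (4K)].  The reciprocity
    [G(m; n) G(n; m) = G(1; mn)], from the Chinese remainder theorem, then
    yields [G(1; n)] for odd [n] (take [m = 4]), and, together with
    [G(a; n) = (a / n) G(1; n)] for odd [n], the value of [G(m; 4K)]. *)

Set Implicit Arguments.
Unset Strict Implicit.
Unset Printing Implicit Defensive.

Import Order.TTheory GRing.Theory Num.Theory.
Local Open Scope ring_scope.
Local Open Scope complex_scope.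

(** * Quadratic Gauss sums over arbitrary roots of unity *)

(** With z = e(1/n), G(a; n) is [gauss n (z ^+ a)]. Keeping z in an arbitrary ring lets the same
    lemmas apply to algebraic numbers and to [R[i]]. *)
Definition gauss (F : pzRingType) (n : nat) (z : F) : F :=
  \sum_(j < n) z ^+ (j ^ 2).

Lemma modn_mulI (n b i j : nat) :
  coprime b n -> b * i = b * j %[mod n] -> i = j %[mod n].
Proof.
move=> bn; wlog ij : i j / (i <= j)%N => [W|].
  by case/orP: (leq_total i j) => ij; [exact: W|move/esym/W => ->].
move=> /esym/eqP; rewrite eqn_mod_dvd ?leq_mul2l ?ij ?orbT // -mulnBr.
by rewrite Gauss_dvdr 1?coprime_sym // -eqn_mod_dvd // => /eqP.
Qed.

(** An injective self-map of the finite set of residues is a permutation. This is the change of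
    variable behind all later substitutions: scalings, shifts and powers of a generator. *)
Lemma sum_residues (V : nmodType) (n : nat) (f : nat -> V) (h : 'I_n -> nat) :
  (forall x, f (x %% n)%N = f x) ->
  (forall i j : 'I_n, h i = h j %[mod n] -> i = j %[mod n]) ->
  \sum_(i < n) f (h i) = \sum_(i < n) f i.
Proof.
case: n h => [|n] h fP hI; first by rewrite !big_ord0.
pose s (i : 'I_n.+1) : 'I_n.+1 := inord (h i %% n.+1).
have sE i : val (s i) = (h i %% n.+1)%N by apply: inordK; rewrite ltn_pmod.
have sI : injective s.
  move=> i j /(congr1 val); rewrite !sE => /hI.
  by rewrite !modn_small //; apply: val_inj.
rewrite [RHS](reindex_inj sI); apply: eq_bigr => i _.
by rewrite [nat_of_ord (s i)]sE fP.
Qed.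

Lemma expr_eqmod (F : pzRingType) (n : nat) (z : F) (a b : nat) :
  z ^+ n = 1 -> a = b %[mod n] -> z ^+ a = z ^+ b.
Proof. by move=> zn ab; rewrite -(expr_mod a zn) ab expr_mod. Qed.

Lemma gauss_modn (F : pzRingType) (n a b : nat) (z : F) :
  z ^+ n = 1 -> a = b %[mod n] -> gauss n (z ^+ a) = gauss n (z ^+ b).
Proof. by move=> zn ab; rewrite (expr_eqmod zn ab). Qed.

Lemma gauss_mul_sqr (F : pzRingType) (n a b : nat) (z : F) :
  z ^+ n = 1 -> coprime b n -> gauss n (z ^+ (a * b ^ 2)) = gauss n (z ^+ a).
Proof.
move=> zn bn; rewrite /gauss.
rewrite -(@sum_residues _ n (fun x => (z ^+ a) ^+ (x ^ 2)) (fun i => b * i)%N).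
- by apply: eq_bigr => j _; rewrite -!exprM expnMn mulnA.
- move=> x; rewrite -!exprM; apply: (expr_eqmod zn).
  by rewrite -modnMmr modnXm modnMmr.
- by move=> i j; apply: modn_mulI.
Qed.

(** Put j = n x + m y: modulo m n the cross term of the square disappears. For z = e(1/mn) the two
    factors are G(n; m) and G(m; n), so this is the reciprocity formula. *)
Lemma gauss_crt (F : comNzRingType) (m n : nat) (z : F) :
  coprime m n -> z ^+ (m * n) = 1 ->
  gauss (m * n) z = gauss m (z ^+ (n ^ 2)) * gauss n (z ^+ (m ^ 2)).
Proof.
move=> cmn zmn.
have [m0|m0] := posnP m.
  by rewrite /gauss m0 mul0n !big_ord0 mul0r.
have [n0|n0] := posnP n.
  by rewrite /gauss n0 muln0 !big_ord0 mulr0.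
have mn0 : (0 < m * n)%N by rewrite muln_gt0 m0.
pose h (p : 'I_m * 'I_n) : 'I_(m * n) :=
  Ordinal (ltn_pmod (n * p.1 + m * p.2) mn0).
have hI : injective h.
  move=> [x y] [x' y'] /(congr1 val) /= /eqP; rewrite chinese_remainder //.
  have Em u v : n * u + m * v = n * u %[mod m] by rewrite addnC mulnC modnMDl.
  have En u v : n * u + m * v = m * v %[mod n] by rewrite mulnC modnMDl.
  rewrite !Em !En.
  case/andP=> /eqP Ex /eqP Ey.
  have /eqP := modn_mulI (etrans (coprime_sym n m) cmn) Ex.
  rewrite !modn_small // => /eqP/val_inj ->.
  by have /eqP := modn_mulI cmn Ey; rewrite !modn_small // => /eqP/val_inj ->.
have hB : bijective h.
  by apply: inj_card_bij hI _; rewrite card_prod !card_ord.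
rewrite /gauss big_distrl /=; under [RHS]eq_bigr do rewrite big_distrr /=.
rewrite pair_big /= (reindex h) /=; last exact: onW_bij.
apply: eq_bigr => -[x y] _ /=; rewrite -!exprM -exprD.
apply: (expr_eqmod zmn); rewrite modnXm.
have -> : ((n * x + m * y) ^ 2 =
  (2 * x * y) * (m * n) + (n ^ 2 * x ^ 2 + m ^ 2 * y ^ 2))%N by ring.
by rewrite modnMDl.
Qed.

(** Orthogonality of characters: if n does not divide a, multiplying the geometric sum by the
    nonzero [z ^+ a - 1] gives 0. *)
Lemma sum_expr_prim (F : fieldType) (n a : nat) (z : F) :
  n.-primitive_root z ->
  \sum_(j < n) z ^+ (a * j) = if (n %| a)%N then n%:R else 0.
Proof.
move=> zn; under eq_bigr do rewrite exprM.
rewrite (prim_order_dvd zn); case: ifPn => [/eqP ->|].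
  by under eq_bigr do rewrite expr1n; rewrite sumr_const card_ord.
rewrite -subr_eq0 => za.
apply: (mulfI za); rewrite mulr0 -subrX1 -exprM mulnC exprM (prim_expr_order zn).
by rewrite expr1n subrr.
Qed.

(** The inverse root plays the part of complex conjugation, so any field will do. Writing the two
    indices as l and l + d, the sum over l of z^(2dl) vanishes unless n divides 2d. *)
Lemma gauss_normM (F : fieldType) (n : nat) (z : F) :
  n.-primitive_root z ->
  gauss n z * gauss n z^-1 =
    n%:R * \sum_(d < n | (n %| 2 * d)%N) z ^+ (d ^ 2).
Proof.
move=> zn; have z1 := prim_expr_order zn.
have z0 : z != 0 by rewrite (prim_root_eq0 zn) -lt0n (prim_order_gt0 zn).
rewrite /gauss mulrC big_distrl /=.
under eq_bigr => l _.
  rewrite -(@sum_residues _ n (fun x => z ^+ (x ^ 2)) (fun d => l + d)%N) /=.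
  - rewrite big_distrr /=.
    under eq_bigr => d _.
      have -> : z^-1 ^+ (l ^ 2) * z ^+ ((l + d) ^ 2) =
          z ^+ (d ^ 2) * z ^+ (2 * d * l).
        rewrite exprVn; apply: (mulfI (expf_neq0 (l ^ 2) z0)).
        rewrite mulVKf ?expf_neq0 // -!exprD; congr (_ ^+ _); ring.
      over.
    over.
  - by move=> x; apply: (expr_eqmod z1); rewrite modnXm.
  - by move=> i j /eqP; rewrite eqn_modDl => /eqP.
rewrite exchange_big /= big_distrr /= [RHS]big_mkcond /=.
apply: eq_bigr => d _; rewrite -big_distrr /= (sum_expr_prim _ zn).
by case: ifP => _; rewrite ?mulr0 // mulrC.
Qed.

(** * Prime and prime-power moduli *)

(** The multiplicative group of ['F_p] is cyclic. The generator is given as a natural number because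
    its powers serve as exponents of a root of unity. *)
Lemma primitive_root_mod_prime (p : nat) : prime p -> exists g : nat,
  [/\ forall i j, g ^ i = g ^ j %[mod p] -> i = j %[mod p.-1],
      g ^ p.-1 = 1 %[mod p] &
      forall a, ~~ (p %| a)%N -> exists i, a = g ^ i %[mod p]].
Proof.
move=> pp; have p1 : (0 < p.-1)%N by rewrite -subn1 subn_gt0 prime_gt1.
have E a b : (a = b %[mod p]) <-> (a%:R = b%:R :> 'F_p).
  split=> [ab | /(congr1 val)]; last by rewrite /= !val_Fp_nat.
  by apply: val_inj; rewrite /= !val_Fp_nat.
have card_F : #|'F_p| = p by rewrite card_Fp.
have fermat (x : 'F_p) : x != 0 -> x ^+ p.-1 = 1.
  move=> x0; apply: (mulfI x0); rewrite mulr1 -exprS prednK ?prime_gt0 //.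
  by rewrite -[X in x ^+ X]card_F expf_card.
have /hasP[g _ gP] : has p.-1.-primitive_root (enum (predC1 (0 : 'F_p))).
  apply: has_prim_root => //.
  - by apply/allP => x; rewrite mem_enum => /fermat x0; apply/unity_rootP.
  - by rewrite enum_uniq.
  - by rewrite -cardE cardC1 card_F.
have gX i : ((g : nat) ^ i)%:R = g ^+ i by rewrite natrX natr_Zp.
exists g; split.
- by move=> i j /E; rewrite !gX => /eqP; rewrite (eq_prim_root_expr gP) => /eqP.
- by apply/E; rewrite gX prim_expr_order.
move=> a pa; have [|i ai] := prim_rootP gP (x := a%:R).
  apply: fermat; apply: contra pa => /eqP a0.
  by apply/dvdnP; exists (a %/ p)%N; rewrite {1}(divn_eq a p) -val_Fp_nat // a0 addn0.
by exists i; apply/E; rewrite gX.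
Qed.

Lemma sum_double (V : nmodType) (n : nat) (f : nat -> V) :
  \sum_(i < n) (f (2 * i)%N + f (2 * i + 1)%N) = \sum_(i < n + n) f i.
Proof.
elim: n => [|n IH]; first by rewrite !big_ord0.
have -> : (n.+1 + n.+1 = (n + n).+2)%N by lia.
by rewrite !big_ord_recr IH /= mul2n -addnn addn1 addrA.
Qed.

Lemma sum_mul_ord (V : nmodType) (a b : nat) (f : nat -> V) :
  \sum_(j < a * b) f j = \sum_(x < a) \sum_(y < b) f (x + a * y)%N.
Proof.
elim: b => [|b IH].
  by rewrite muln0 big_ord0 big1 // => x _; rewrite big_ord0.
rewrite mulnSr big_split_ord /= IH -big_split /=; apply: eq_bigr => x _.
by rewrite big_ord_recr /= addnC.
Qed.

(** Write a as a power of a generator g. An even power is a square and is absorbed by a scaling of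
    the index; an odd power leaves one factor g, which changes the sign of the sum. *)
Lemma gauss_prime (F : fieldType) (p a : nat) (z : F) :
  prime p -> p.-primitive_root z -> ~~ (p %| a)%N ->
  gauss p (z ^+ a) = (legendre a p)%:~R * gauss p z.
Proof.
move=> pp zp pa; have z1 := prim_expr_order zp.
have [g [gI g1 gS]] := primitive_root_mod_prime pp.
have p0 := prime_gt0 pp.
have pg i : ~~ (p %| g ^ i)%N.
  have [-> | i0] := posnP i; first by rewrite Euclid_dvd1.
  rewrite Euclid_dvdX // i0 andbT; apply/negP => /dvdn_exp - /(_ p.-1).
  rewrite -subn1 subn_gt0 prime_gt1 // subn1 /dvdn g1 modn_small ?prime_gt1 //.
  by move=> /(_ isT).
have sum_gen (f : nat -> F) : (forall x, f (x %% p)%N = f x) ->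
    \sum_(x < p) f x = f 0%N + \sum_(i < p.-1) f (g ^ i)%N.
  move=> fP.
  (* [h] lists the residues as 0, g^0, ..., g^(p-2): an index i > 0 carries the exponent i - 1. *)
  pose h (i : 'I_p) := if i == 0%N :> nat then 0%N else (g ^ i.-1)%N.
  rewrite -(@sum_residues _ p f h) //.
    by rewrite /h; case: (p) p0 => // p' _; rewrite big_ord_recl.
  move=> i j; rewrite /h; case: eqVneq => i0; case: eqVneq => j0.
  - by rewrite i0 j0.
  - by move/esym/eqP; rewrite mod0n -/(dvdn _ _) (negPf (pg _)).
  - by move/eqP; rewrite mod0n -/(dvdn _ _) (negPf (pg _)).
  move/gI; have := ltn_ord i; have := ltn_ord j => ip jp.
  by rewrite !modn_small; lia.
have per x : z ^+ (x %% p) = z ^+ x by rewrite expr_mod.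
have sum_z : 1 + \sum_(i < p.-1) z ^+ (g ^ i) = 0.
  rewrite -(@sum_gen (fun x => z ^+ x)) //.
  under eq_bigr => i _ do rewrite -[nat_of_ord i]mul1n.
  by rewrite (sum_expr_prim _ zp) dvdn1 gtn_eqF ?prime_gt1.
have gaussg e : gauss p (z ^+ (g ^ e)) = 1 + \sum_(i < p.-1) z ^+ (g ^ (2 * i + e)).
  rewrite /gauss.
  rewrite (@sum_gen (fun x => (z ^+ (g ^ e)) ^+ (x ^ 2))) => [|x]; last first.
    by rewrite -!exprM; apply: (expr_eqmod z1); rewrite -modnMmr modnXm modnMmr.
  congr (_ + _); apply: eq_bigr => i _; rewrite -exprM; congr (_ ^+ _).
  by rewrite -expnM -expnD mulnC addnC.
(* Squares and non-squares together run twice through all nonzero residues. *)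
have gaussN : gauss p (z ^+ g) = - gauss p z.
  apply/eqP; rewrite -addr_eq0 addrC; apply/eqP.
  have := gaussg 0%N; rewrite expn0 expr1 => ->.
  have := gaussg 1%N; rewrite expn1 => ->.
  rewrite addrACA -big_split /=.
  under eq_bigr do rewrite addn0.
  rewrite (@sum_double _ _ (fun i => z ^+ (g ^ i))) big_split_ord /=.
  have -> : \sum_(i < p.-1) z ^+ (g ^ (p.-1 + i)) = \sum_(i < p.-1) z ^+ (g ^ i).
    apply: eq_bigr => i _; apply: (expr_eqmod z1).
    by rewrite expnD -modnMml g1 modnMml mul1n.
  by rewrite addrACA sum_z addr0.
have gauss_sqr b c : ~~ (p %| b)%N ->
    gauss p (z ^+ (c * b ^ 2)) = gauss p (z ^+ c).
  by move=> pb; apply: gauss_mul_sqr; rewrite // coprime_sym prime_coprime.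
rewrite /legendre (negPf pa); case: ifPn => [/existsP[x /eqP xa] | nsq].
  have px : ~~ (p %| x)%N.
    by apply: contra pa => px; rewrite /dvdn -xa -/(dvdn _ _) dvdn_mulr.
  by rewrite mul1r -(gauss_modn z1 xa) -(mul1n (x ^ 2)%N) gauss_sqr.
have [i ai] := gS _ pa; rewrite (gauss_modn z1 ai) mulrN1z mulN1r -gaussN.
(* For odd i, a is g times the square of g^(i/2). For even i, g^(i/2) reduced mod p is a square root
   of a, against [nsq]. *)
have := odd_double_half i; case: (odd i) => iE; rewrite -iE -muln2 /=.
  by rewrite expnD expn1 expnM gauss_sqr.
case/negP: nsq; apply/existsP; exists (Ordinal (ltn_pmod (g ^ i./2) p0)).
by rewrite /= modnXm -expnM ai muln2 -[in X in _ == X]iE.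
Qed.

(** Put j = x + p^(k+1) y, so that j^2 is x^2 + 2xy p^(k+1) modulo p^(k+2). As p is odd, the sum
    over y is p if p divides x and 0 otherwise. *)
Lemma gauss_prime_power_rec (F : fieldType) (p k : nat) (z : F) :
  prime p -> odd p -> (p ^ k.+2).-primitive_root z ->
  gauss (p ^ k.+2) z = p%:R * gauss (p ^ k) (z ^+ (p ^ 2)).
Proof.
move=> pp po zp; have z1 := prim_expr_order zp.
have zp1 : p.-primitive_root (z ^+ (p ^ k.+1)).
  have := @dvdn_prim_root _ _ _ zp p.
  by rewrite expnS dvdn_mulr // mulKn ?prime_gt0 //; apply.
rewrite /gauss expnSr (@sum_mul_ord _ _ _ (fun j => z ^+ (j ^ 2))).
under eq_bigr => x _.
  under eq_bigr => y _.
    have -> : z ^+ ((x + p ^ k.+1 * y) ^ 2) =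
        z ^+ (x ^ 2) * (z ^+ (p ^ k.+1)) ^+ (2 * x * y).
      rewrite -exprM -exprD; apply: (expr_eqmod z1).
      have -> : ((x + p ^ k.+1 * y) ^ 2 = p ^ k * y ^ 2 * p ^ k.+2 +
          (x ^ 2 + p ^ k.+1 * (2 * x * y)))%N.
        by case: x => x _ /=; rewrite (expnS p k.+1) (expnS p k); ring.
      by rewrite modnMDl.
    over.
  rewrite -big_distrr /= (sum_expr_prim _ zp1) Gauss_dvdr; last first.
    by rewrite coprimen2.
  over.
(* A second splitting, of x into a residue mod p plus p u: only the residue 0 survives. *)
rewrite expnS.
rewrite (@sum_mul_ord _ _ _
  (fun x => z ^+ (x ^ 2) * (if (p %| x)%N then p%:R else 0))).
rewrite (bigD1 (Ordinal (prime_gt0 pp))) //= [X in _ + X]big1 => [|x x0].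
  rewrite addr0 big_distrr /=; apply: eq_bigr => u _.
  by rewrite dvdn_mulr // mulrC -exprM expnMn.
apply: big1 => y _; rewrite addnC mulnC /dvdn modnMDl -/(dvdn _ _) gtnNdvd ?mulr0 //.
by rewrite lt0n.
Qed.

Lemma sqr_legendre (a p : nat) : ~~ (p %| a)%N -> legendre a p ^+ 2 = 1.
Proof. by move=> pa; rewrite /legendre (negPf pa); case: ifP. Qed.

(** The recursion lowers k by 2, which does not affect the power of the Legendre symbol because its
    square is 1; the base cases are k = 0 and k = 1. *)
Lemma gauss_prime_power (F : fieldType) (p k a : nat) (z : F) :
  prime p -> odd p -> (p ^ k).-primitive_root z -> ~~ (p %| a)%N ->
  gauss (p ^ k) (z ^+ a) = (legendre a p ^+ k)%:~R * gauss (p ^ k) z.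
Proof.
move=> pp po + pa; move: k z.
apply: (@ltn_ind (fun k => forall z : F, (p ^ k).-primitive_root z -> _)) => k IH z zp.
case: k IH zp => [|[|k]] IH zp.
- by rewrite /gauss !big_ord1 !expr0 mul1r.
- by move: zp; rewrite expn1 expr1 => zp; apply: gauss_prime.
have zap : (p ^ k.+2).-primitive_root (z ^+ a).
  by rewrite (prim_root_exp_coprime _ zp) coprime_sym coprimeXl // prime_coprime.
rewrite !gauss_prime_power_rec // exprAC IH //; last first.
  have := @dvdn_prim_root _ _ _ zp (p ^ k).
  by rewrite -addn2 expnD dvdn_mulr // mulKn ?expn_gt0 ?prime_gt0 //; apply.
have -> : legendre a p ^+ k.+2 = legendre a p ^+ k.
  by rewrite -addn2 exprD sqr_legendre // mulr1.
by rewrite mulrCA.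
Qed.

(** For odd n only d = 0 contributes to [gauss_normM], and n is nonzero in a field with a primitive
    n-th root of unity. *)
Lemma gauss_odd_neq0 (F : fieldType) (n : nat) (z : F) :
  odd n -> n.-primitive_root z -> gauss n z != 0.
Proof.
move=> no zn; have n0 := prim_order_gt0 zn.
have : gauss n z * gauss n z^-1 != 0.
  rewrite (gauss_normM zn) mulf_neq0 ?(prim_root_natf_neq0 zn) //.
  rewrite (bigD1 (Ordinal n0)) ?muln0 //= big1 ?addr0 ?oner_neq0 // => d.
  rewrite Gauss_dvdr ?coprimen2 // => /andP[nd]; rewrite -val_eqE /= => d0.
  by move: nd; rewrite gtnNdvd // lt0n.
by rewrite mulf_eq0 negb_or => /andP[].
Qed.

(** * Odd moduli and the Jacobi symbol *)

(** When p divides neither factor, evaluate G(ab; p) over the algebraic numbers in two ways, cancel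
    the nonzero G(1; p), and use that integers embed in characteristic 0. *)
Lemma legendreM (a b p : nat) : prime p -> odd p ->
  legendre (a * b) p = legendre a p * legendre b p.
Proof.
move=> pp po; have [pa|pa] := boolP (p %| a)%N.
  by rewrite /legendre dvdn_mulr // pa mul0r.
have [pb|pb] := boolP (p %| b)%N.
  by rewrite /legendre dvdn_mull // pb mulr0.
have pab : ~~ (p %| a * b)%N by rewrite Euclid_dvdM // negb_or pa.
have [z zp] := C_prim_root_exists (prime_gt0 pp).
have zap : p.-primitive_root (z ^+ a).
  by rewrite (prim_root_exp_coprime _ zp) coprime_sym prime_coprime.
have := gauss_prime pp zp pab; rewrite exprM !gauss_prime // mulrA => /esym.
move/(mulIf (gauss_odd_neq0 po zp)); rewrite -intrM mulrC => /intr_inj ->.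
by [].
Qed.

Lemma jacobiM (a b n : nat) : odd n ->
  jacobi (a * b) n = jacobi a n * jacobi b n.
Proof.
move=> no; rewrite /jacobi -big_split /=; apply: eq_big_seq => p.
rewrite mem_primes => /and3P[pp _ pn]; rewrite legendreM ?exprMn //.
exact: dvdn_odd pn no.
Qed.

Lemma jacobi_prime_powerM (a p k n : nat) : prime p -> (0 < k)%N -> (0 < n)%N ->
  coprime p n -> jacobi a (p ^ k * n) = legendre a p ^+ k * jacobi a n.
Proof.
move=> pp k0 n0 pn; have pk0 : (0 < p ^ k)%N by rewrite expn_gt0 prime_gt0.
have pNn : p \notin primes n.
  by rewrite mem_primes pp n0 /= -prime_coprime.
have perm : perm_eq (primes (p ^ k * n)) (p :: primes n).
  apply: uniq_perm; rewrite ?primes_uniq //= ?pNn ?primes_uniq // => q.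
  by rewrite primesM // primesX // primes_prime // !inE.
rewrite /jacobi (perm_big _ perm) big_cons /= mulnC logn_Gauss // pfactorK //.
congr (_ * _); apply: eq_big_seq => q qn; rewrite mulnC logn_Gauss //.
move: qn; rewrite mem_primes => /and3P[pq _ qn]; apply: coprimeXr.
rewrite prime_coprime // dvdn_prime2 //; apply: contraTneq qn => ->.
by rewrite -prime_coprime.
Qed.

(** Strong induction on n: split off the full power of one prime by [gauss_crt], then apply
    [gauss_prime_power] to that power and the induction hypothesis to the cofactor. *)
Lemma gauss_jacobi (F : fieldType) (n a : nat) (z : F) :
  odd n -> n.-primitive_root z -> coprime a n ->
  gauss n (z ^+ a) = (jacobi a n)%:~R * gauss n z.
Proof.
move: n a z; apply: (@ltn_ind (fun n => forall a (z : F), odd n -> _)).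
move=> n IH a z no zn an.
have n0 := prim_order_gt0 zn; have z1 := prim_expr_order zn.
case: (ltngtP n 1%N) => [|n1|->]; first by case: n n0 {IH no zn z1 an}.
  move: (pdiv_prime n1) (pdiv_dvd n); move: (pdiv n) => p pp pn.
  have po : odd p := dvdn_odd pn no.
  have k0 : (0 < logn p n)%N by rewrite logn_gt0 mem_primes pp n0.
  have [m pm] := pfactor_coprime pp n0; move: (logn p n) k0 => k k0 nE.
  rewrite mulnC in nE.
  have m0 : (0 < m)%N by move: n0; rewrite nE muln_gt0 => /andP[].
  have mo : odd m by move: no; rewrite nE oddM => /andP[].
  have mn : (m < n)%N.
    by rewrite nE -[X in (X < _)%N]mul1n ltn_pmul2r // -(exp1n k) ltn_exp2r // prime_gt1.
  have zq : (p ^ k).-primitive_root (z ^+ m).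
    have := @dvdn_prim_root _ _ _ zn (p ^ k).
    by rewrite nE dvdn_mulr // mulKn ?expn_gt0 ?prime_gt0 //; apply.
  have zm : m.-primitive_root (z ^+ (p ^ k)).
    by have := @dvdn_prim_root _ _ _ zn m; rewrite nE dvdn_mull // mulnK //; apply.
  have cqm : coprime (p ^ k) m by rewrite coprimeXl.
  (* Used for b = 1 and b = a. The splitting introduces the extra symbols of m mod p and of p^k mod
     m; they occur in both cases, so only the symbols of a remain. *)
  have step b : coprime b n -> gauss n (z ^+ b) =
      (legendre (b * m) p ^+ k)%:~R * (jacobi (b * p ^ k) m)%:~R *
      (gauss (p ^ k) (z ^+ m) * gauss m (z ^+ (p ^ k))).
    move=> bn; rewrite {1}nE gauss_crt //; last by rewrite -nE exprAC z1 expr1n.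
    have -> : (z ^+ b) ^+ (m ^ 2) = (z ^+ m) ^+ (b * m).
      by rewrite -!exprM; congr (_ ^+ _); ring.
    have -> : (z ^+ b) ^+ ((p ^ k) ^ 2) = (z ^+ (p ^ k)) ^+ (b * p ^ k).
      by rewrite -!exprM; congr (_ ^+ _); ring.
    move: bn; rewrite nE coprimeMr => /andP[bp bm].
    rewrite (gauss_prime_power pp po zq); last first.
      rewrite -prime_coprime // coprimeMr pm andbT coprime_sym.
      by move: bp; rewrite coprime_pexpr.
    have bqm : coprime (b * p ^ k) m by rewrite coprimeMl bm.
    by rewrite (IH m mn _ _ mo zm bqm) mulrACA.
  have := step 1%N (coprime1n _); rewrite !mul1n expr1 => ->.
  have -> : jacobi a n = legendre a p ^+ k * jacobi a m.
    by rewrite nE jacobi_prime_powerM.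
  rewrite (step _ an) legendreM // jacobiM // exprMn !intrM.
  by rewrite -!mulrA; congr (_ * _); rewrite mulrCA.
by rewrite /gauss !big_ord1 !expr0 /jacobi big_nil mulr1.
Qed.

(** * Evaluation of the complex Gauss sums *)

(** Two evaluations of one q-series coefficient [D n]: a first-order recurrence makes it a product,
    and the values of Gaussian binomials at a root of unity make it the quadratic sum. *)
Lemma gauss_product (F : fieldType) (n : nat) (t : F) :
  n.+1.-primitive_root (t ^+ 2) ->
  \sum_(j < n.+1) t ^+ (j ^ 2) = \prod_(i < n) (1 + (- t) ^- i.+1).
Proof.
move=> tn; have t20 : t ^+ 2 != 0 by rewrite (prim_root_eq0 tn).
have t0 : t != 0 by move: t20; rewrite expf_eq0.
pose s := (- t)^-1; have s0 : s != 0 by rewrite invr_eq0 oppr_eq0.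
pose q := s ^+ 2.
have qE : q = (t ^+ 2)^-1 by rewrite /q /s exprVn sqrrN.
have qn : n.+1.-primitive_root q.
  have := prim_root_exp_coprime n tn; rewrite (coprimenS n) => tnn.
  suff -> : q = (t ^+ 2) ^+ n by [].
  by apply: (mulfI t20); rewrite -exprS (prim_expr_order tn) qE mulfV.
have q1 i : (0 < i <= n)%N -> 1 - q ^+ i != 0.
  case/andP=> i0 iln; rewrite subr_eq0 eq_sym -(prim_order_dvd qn).
  by apply: contraL iln => /(dvdn_leq i0); rewrite -ltnNge.
(* The sum is [D n], up to the factor [a n]; [D m] is the coefficient of [x^m]
   in [A(s x) A(x)] with [A(x) = \sum_j a j x^j = \prod_i 1 / (1 - q^i x)], that
   is in [\prod_i 1 / (1 - s^i x)]. *)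
pose a j := \prod_(i < j) (1 - q ^+ i.+1)^-1.
have aS j : (j < n)%N -> (1 - q ^+ j.+1) * a j.+1 = a j.
  by move=> jn; rewrite /a big_ord_recr /= mulrCA mulfV ?mulr1 // q1.
have a0 : a 0%N = 1 by rewrite /a big_ord0.
pose D m := \sum_(j < m.+1) s ^+ j * a j * a (m - j)%N.
have Drev m : D m = \sum_(j < m.+1) s ^+ (m - j) * a (m - j)%N * a j.
  rewrite /D (reindex_inj rev_ord_inj) /=; apply: eq_bigr => j _.
  by rewrite subSS subKn // -ltnS.
(* Subtract s^(m+1) times [D m.+1] from its reversed form term by term. The factor 1 - s^(2j) = 1 -
   q^j turns [a j] into [a (j - 1)], and the term j = 0 cancels. *)
have DS m : (m < n)%N -> (1 - s ^+ m.+1) * D m.+1 = D m.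
  move=> mn; rewrite mulrBl mul1r [D m]Drev {1}[D m.+1]Drev /D.
  rewrite big_distrr /= -sumrB big_ord_recl /=.
  rewrite a0 !subn0 expr0 !mul1r mulr1 subrr add0r.
  apply: eq_bigr => j _; rewrite /bump /= add1n subSS.
  have jn : (j < n)%N by rewrite (leq_trans (ltn_ord j)).
  rewrite -(aS j jn).
  have -> : s ^+ m.+1 = s ^+ (m - j) * s ^+ j.+1.
    by rewrite -exprD; congr (_ ^+ _); move: (ltn_ord j); lia.
  by rewrite /q -exprM mulnC exprM expr2; ring.
have Dprod m : (m <= n)%N -> (\prod_(i < m) (1 - s ^+ i.+1)) * D m = 1.
  elim: m => [|m IH] mn.
    by rewrite /D big_ord0 big_ord1 subnn a0 expr0 !mulr1.
  by rewrite big_ord_recr -mulrA DS // IH // ltnW.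
(* [a j * a (n - j) / a n] is the Gaussian binomial coefficient, which for q^(n+1) = 1 equals (-1)^j
   q^(-j(j+1)/2). *)
have aa j : (j <= n)%N -> a j * a (n - j)%N * s ^+ (j * j.+1) = (- 1) ^+ j * a n.
  elim: j => [|j IH] jn; first by rewrite a0 subn0 expr0 mulr1.
  have nj : (n - j = (n - j.+1).+1)%N by lia.
  have anj : a (n - j.+1)%N = (1 - q ^+ (n - j)) * a (n - j)%N.
    by rewrite nj aS //; lia.
  have qq : q ^+ (n - j) * q ^+ j.+1 = 1.
    rewrite -exprD -(prim_expr_order qn); congr (_ ^+ _); lia.
  rewrite exprS mulN1r mulNr -IH ?(ltnW jn) // -(aS j jn) anj.
  have -> : s ^+ (j.+1 * j.+2) = q ^+ j.+1 * s ^+ (j * j.+1).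
    by rewrite /q -exprM -exprD; congr (_ ^+ _); lia.
  transitivity (a j.+1 * a (n - j)%N * s ^+ (j * j.+1) *
    (q ^+ j.+1 - q ^+ (n - j) * q ^+ j.+1)); first by ring.
  by rewrite qq; ring.
have a_neq0 : a n != 0.
  by apply/prodf_neq0 => i _; rewrite invr_eq0 q1 //= ltn_ord.
have DE : D n = a n * \sum_(j < n.+1) t ^+ (j ^ 2).
  rewrite /D big_distrr /=; apply: eq_bigr => j _.
  have jn : (j <= n)%N by rewrite -ltnS.
  apply: (mulIf (expf_neq0 (j * j.+1) s0)).
  have -> : s ^+ j * a j * a (n - j)%N * s ^+ (j * j.+1) =
     s ^+ j * (a j * a (n - j)%N * s ^+ (j * j.+1)) by rewrite !mulrA.
  have -> : a n * t ^+ (j ^ 2) * s ^+ (j * j.+1) =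
     s ^+ j * (t * s) ^+ (j ^ 2) * a n.
    by rewrite exprMn mulnS exprD mulnn; ring.
  have -> : t * s = -1 by rewrite /s invrN mulrN mulfV.
  by rewrite (aa j jn) mulrA -[in RHS]signr_odd oddX /= signr_odd.
have : a n != 0 -> \sum_(j < n.+1) t ^+ (j ^ 2) = (a n)^-1 * D n.
  by move=> an; rewrite DE mulKf.
move/(_ a_neq0) ->.
have -> : D n = (\prod_(i < n) (1 - s ^+ i.+1))^-1.
  have PD := Dprod n (leqnn n).
  have P0 : \prod_(i < n) (1 - s ^+ i.+1) != 0.
    by apply: contra_eq_neq PD => ->; rewrite mul0r eq_sym oner_eq0.
  by apply: (mulfI P0); rewrite PD mulfV.
(* The inverse of [a n] is the product of 1 - q^i = (1 - s^i)(1 + s^i) for 0 < i <= n; dividing by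
   the factors 1 - s^i leaves the claim. *)
rewrite /a -!prodfV -big_split /=; apply: eq_bigr => i _.
have sE : 1 - q ^+ i.+1 = (1 - s ^+ i.+1) * (1 + s ^+ i.+1).
  by rewrite /q -exprM mulnC exprM; ring.
have : 1 - q ^+ i.+1 != 0 by rewrite q1 //= ltn_ord.
rewrite invrK -exprVn -/s sE mulf_eq0 negb_or => /andP[si _].
by rewrite mulrAC mulfV ?mul1r.
Qed.

(** * Complex roots of unity and the sum modulo 4K *)

Lemma cisD (R : realType) (x y : R) : cis (x + y) = cis x * cis y.
Proof. by rewrite /cis cosD sinD; simpc; congr (_ +i* _); rewrite addrC. Qed.

Lemma cis0 (R : realType) : cis 0 = 1 :> R[i].
Proof. by rewrite /cis cos0 sin0. Qed.

Lemma cisX (R : realType) (x : R) (k : nat) : cis x ^+ k = cis (k%:R * x).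
Proof.
elim: k => [|k IH]; first by rewrite mul0r cis0.
by rewrite exprS IH -cisD -natr1 mulrDl mul1r addrC.
Qed.

Lemma cis_neq0 (R : realType) (x : R) : cis x != 0.
Proof.
have : cis (- x) * cis x != 0 by rewrite -cisD addNr cis0 oner_eq0.
by rewrite mulf_eq0 negb_or => /andP[].
Qed.

Lemma cisN (R : realType) (x : R) : cis (- x) = (cis x)^-1.
Proof.
by apply: (mulIf (cis_neq0 x)); rewrite mulVf ?cis_neq0 // -cisD addNr cis0.
Qed.

Lemma conjc_cis (R : realType) (x : R) : conjc (cis x) = (cis x)^-1.
Proof. by rewrite -cisN /cis cosN sinN. Qed.

Definition zeta (R : realType) (n : nat) : R[i] := cis (2 * pi / n%:R).

Lemma zetaX (R : realType) (n k : nat) :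
  zeta R n ^+ k = cis (2 * pi * k%:R / n%:R).
Proof. by rewrite cisX; congr cis; ring. Qed.

Lemma zeta_mul (R : realType) (m n : nat) : (0 < m)%N ->
  zeta R (m * n) ^+ m = zeta R n.
Proof.
move=> m0; rewrite zetaX natrM invfM mulrA mulfK // pnatr_eq0 -lt0n.
exact: m0.
Qed.

Lemma zeta_prim (R : realType) (n : nat) : (0 < n)%N ->
  n.-primitive_root (zeta R n).
Proof.
move=> n0; have nR : (0 : R) < n%:R by rewrite ltr0n.
have cis2pi : cis (2 * pi) = 1 :> R[i] by rewrite /cis mulr_natl cos2pi sin2pi.
apply/andP; split => //; apply/forallP => i; apply/eqP.
rewrite unity_rootE zetaX; case: (ltngtP i.+1 n) (ltn_ord i) => // [in0 _|-> _].
  (* The real part of the equation says cos(2y) = 1, hence sin y = 0, although 0 < y < pi. *)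
  apply/negbTE/eqP => /(congr1 (@complex.Re R)) /=.
  set y : R := pi * i.+1%:R / n%:R.
  have -> : 2 * pi * i.+1%:R / n%:R = y *+ 2 by rewrite /y -mulr_natl; ring.
  rewrite cos_mulr2n => h.
  have : 0 < sin y.
    apply: sin_gt0_pi; rewrite divr_gt0 ?mulr_gt0 ?pi_gt0 ?ltr0n //=.
    by rewrite ltr_pdivrMr // ltr_pM2l ?pi_gt0 // ltr_nat.
  have := cos2Dsin2 y; nra.
by rewrite mulfK ?cis2pi ?eqxx // gt_eqF.
Qed.

Lemma zeta4 (R : realType) : zeta R 4 = 'i.
Proof.
rewrite /zeta; have -> : 2 * pi / 4 = pi / 2 :> R by field.
by rewrite /cis cos_pihalf sin_pihalf.
Qed.

Lemma gauss_conj (R : realType) (n k : nat) :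
  conjc (gauss k (zeta R n)) = gauss k (zeta R n)^-1.
Proof.
rewrite /gauss (rmorph_sum (@conjc R)); apply: eq_bigr => j _.
by rewrite rmorphXn /= -conjc_cis.
Qed.

(** With phi = pi i / 4K the left side is 1 + e^(-2i phi) = 2 cos phi e^(-i phi) for even index and
    1 - e^(-2i phi) = 2 sin phi e^(i(pi/2 - phi)) for odd index. The bound on the index gives phi <
    pi/2, hence positivity. *)
Lemma gauss_factor (R : realType) (K i : nat) : (i < 2 * K)%N ->
  exists2 c : R, 0 < c &
    1 + (- zeta R (4 * K)) ^- i =
    c%:C * cis (- (pi * i%:R / (4 * K)%:R) + (odd i)%:R * (pi / 2)).
Proof.
move=> iK; have K0 : (0 < K)%N by lia.
have KR : (0 : R) < (4 * K)%:R by rewrite ltr0n; lia.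
set phi := pi * i%:R / _.
have p0 := pi_gt0 R.
have phi2 : phi < pi / 2.
  rewrite /phi ltr_pdivrMr // -mulrA ltr_pM2l // mulrC.
  rewrite ltr_pdivlMr // -natrM ltr_nat; lia.
have phi0 : 0 <= phi by rewrite divr_ge0 ?mulr_ge0 // ltW.
have zE : (- zeta R (4 * K)) ^- i = (-1) ^+ odd i * cis (- (phi *+ 2)).
  rewrite (exprNn (zeta R _)) invfM invr_sign signr_odd zetaX -cisN; congr (_ * cis _).
  by rewrite /phi -mulr_natl; ring.
have cs : cos phi ^+ 2 + sin phi ^+ 2 = 1 := cos2Dsin2 phi.
rewrite {}zE; case: (boolP (odd i)) => io.
  exists (2 * sin phi).
    rewrite mulr_gt0 // sin_gt0_pihalf // phi2 andbT lt_neqAle phi0 andbT.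
    rewrite eq_sym mulf_neq0 ?mulf_neq0 ?invr_eq0 ?gt_eqF //.
    by rewrite ltr0n; case: (i) io.
  rewrite expr1 mulN1r mul1r cisD {3}/cis cos_pihalf sin_pihalf.
  rewrite /cis !cosN !sinN cos_mulr2n sin_mulr2n; simpc.
  congr (_ +i* _); lra.
exists (2 * cos phi).
  rewrite mulr_gt0 // cos_gt0_pihalf // phi2 andbT (lt_le_trans _ phi0) //.
  by rewrite oppr_lt0 divr_gt0.
rewrite expr0 mul1r mul0r addr0.
rewrite /cis !cosN !sinN cos_mulr2n sin_mulr2n; simpc.
by congr (_ +i* _); ring: cs.
Qed.

(** Arguments add up: the indices below 2m sum to m(2m - 1), and the m odd ones contribute a quarter
    turn each. *)
Lemma gauss_product_arg (R : realType) (K m : nat) : (0 < K)%N -> (m <= K)%N ->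
  exists2 c : R, 0 < c &
    \prod_(i < 2 * m) (1 + (- zeta R (4 * K)) ^- i) =
    c%:C * cis (- (pi * (m * (2 * m - 1))%N%:R / (4 * K)%:R) + m%:R * (pi / 2)).
Proof.
move=> K0; elim: m => [|m IH] mK.
  exists 1 => //; rewrite muln0 big_ord0 !mul0r mul0n mulr0 mul0r oppr0 addr0.
  by rewrite cis0 mulr1.
have [c c0 cE] := IH (ltnW mK).
have [c1 c10 c1E] := @gauss_factor R K (2 * m) ltac:(lia).
have [c2 c20 c2E] := @gauss_factor R K (2 * m).+1 ltac:(lia).
exists (c * c1 * c2); first by rewrite !mulr_gt0.
have -> : (2 * m.+1 = (2 * m).+2)%N by lia.
rewrite !big_ord_recr /= cE c1E c2E.
have -> (x y w : R) (u v t : R[i]) : x%:C * u * (y%:C * v) * (w%:C * t) =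
    (x * y * w)%:C * (u * v * t) by rewrite !rmorphM /=; ring.
rewrite -!cisD; congr (_ * cis _).
rewrite /= !oddM /= mul0r addr0.
have -> : (m.+1 * ((2 * m).+2 - 1) = m * (2 * m - 1) + 2 * m + (2 * m).+1)%N.
  by case: (m) => [//|m']; nia.
by rewrite !natrD -!natr1 /=; ring.
Qed.

(** The product formula gives the argument, and [gauss_normM] the modulus. *)
Lemma gauss_4k (R : realType) (K : nat) : (0 < K)%N ->
  gauss (4 * K) (zeta R (4 * K)) = (1 + 'i) * (Num.sqrt (4 * K)%:R)%:C.
Proof.
move=> K0; set t := zeta R (4 * K).
have K4 : (0 < 4 * K)%N by lia.
have tp : (4 * K).-primitive_root t := zeta_prim R K4.
have t1 := prim_expr_order tp.
have t2 : (2 * K).-primitive_root (t ^+ 2).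
  have := @dvdn_prim_root _ _ _ tp (2 * K)%N.
  have -> : (4 * K = 2 * (2 * K))%N by lia.
  by rewrite dvdn_mull // mulnK ?muln_gt0 //; apply.
(* The summand has period 2K, so the sum is twice its first half; this 2 is the factor at i = 0 of
   the product. *)
have gE : gauss (4 * K) t = \prod_(i < 2 * K) (1 + (- t) ^- i).
  have -> : gauss (4 * K) t =
      \sum_(j < 2 * K) t ^+ (j ^ 2) + \sum_(j < 2 * K) t ^+ (j ^ 2).
    rewrite /gauss.
    have -> : (4 * K = 2 * K + 2 * K)%N by lia.
    rewrite big_split_ord /=; congr (_ + _); apply: eq_bigr => j _.
    apply: (expr_eqmod t1).
    have -> : ((2 * K + j) ^ 2 = (K + j) * (4 * K) + j ^ 2)%N by lia.
    by rewrite modnMDl.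
  have n0 : (0 < 2 * K)%N by lia.
  move: t2 n0; case: (2 * K)%N => // n tn _.
  rewrite (gauss_product tn) [RHS]big_ord_recl expr0 invr1 mulrDl !mul1r.
  by [].
have [c c0 cE] := gauss_product_arg R K0 (leqnn K).
(* For m = K the argument is -(2K - 1) pi/4 + K pi/2 = pi/4. *)
have {cE} gE : gauss (4 * K) t = c%:C * cis (pi / 4).
  rewrite gE cE; congr (_ * cis _).
  have KR : K%:R != 0 :> R by rewrite pnatr_eq0 -lt0n.
  rewrite !natrM natrB ?natrM; last by lia.
  by field.
(* The only d < 4K with 4K dividing 2d are 0 and 2K, and each contributes 1. *)
have norm : gauss (4 * K) t * gauss (4 * K) t^-1 = (2 * (4 * K))%:R.
  rewrite (gauss_normM tp) mulrC [RHS]natrM; congr (_ * _).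
  have K2 : (2 * K < 4 * K)%N by lia.
  rewrite (bigD1 (Ordinal K4)) ?muln0 //= expr0 (bigD1 (Ordinal K2)) /=; last first.
    by rewrite -val_eqE /= mulnA dvdnn; lia.
  have -> : t ^+ ((2 * K) ^ 2) = 1.
    have -> : ((2 * K) ^ 2 = (4 * K) * K)%N by lia.
    by rewrite exprM t1 expr1n.
  rewrite big1 ?addr0 // => d; rewrite -!val_eqE /= => /andP[/andP[/dvdnP[e dE]] d0] d1.
  by move: (ltn_ord d) dE d0 d1; case: e => [|[|e]]; lia.
have c4 : cos (pi / 4) = sin (pi / 4) :> R.
  by rewrite -cosBpihalf -cosN; congr cos; field.
have x0 : 0 < cos (pi / 4) :> R.
  by apply: cos_gt0_pihalf; have := pi_gt0 R; lra.
have s0 := cos2Dsin2 (pi / 4 : R).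
set x := cos (pi / 4) in c4 x0 s0.
have cisE : cis (pi / 4) = x%:C * (1 + 'i).
  by rewrite /cis -c4 -/x; simpc.
(* Since cis(pi/4) = x (1 + i) with 2 x^2 = 1, the positive number c x is the square root of 4K. *)
have {}norm : (c * x) ^+ 2 = (4 * K)%:R.
  have conjM (u v : R[i]) : conjc (u * v) = conjc u * conjc v := rmorphM _ u v.
  move: norm; rewrite -gauss_conj gE conjM conjc_cis conjc_real.
  rewrite mulrACA mulfV ?cis_neq0 // mulr1 -rmorphM /= -(rmorph_nat (real_complex R)).
  move/complexI => cc; rewrite -c4 -/x in s0; rewrite natrM in cc.
  have -> : (c * x) ^+ 2 = c * c * x ^+ 2 by ring.
  have -> : x ^+ 2 = 1 / 2 by lra.
  by rewrite cc; field.
by rewrite gE cisE -norm sqrtr_sqr gtr0_norm ?mulr_gt0 // rmorphM /=; ring.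
Qed.

Lemma exprI4 (R : rcfType) (l k : nat) : 'i ^+ (4 * l + k) = 'i ^+ k :> R[i].
Proof.
have i4 : 'i ^+ 4 = 1 :> R[i] by rewrite (exprM _ 2 2) sqr_i expr2 mulrNN mulr1.
by rewrite exprD exprM i4 expr1n mul1r.
Qed.

(** * Values obtained from reciprocity *)

(** G(1; 4n) = G(n; 4) G(4; n), where G(n; 4) = 2(1 + i^n) and G(4; n) = G(1; n) because 4 is a
    square prime to n. Keeping the factor 1 + i^n treats both odd classes mod 4 at once. *)
Lemma gauss_odd (R : realType) (n : nat) : odd n ->
  (1 + 'i ^+ n) * gauss n (zeta R n) = (1 + 'i) * (Num.sqrt n%:R)%:C.
Proof.
move=> no; have n0 : (0 < n)%N by case: (n) no.
have c4n : coprime 4 n by rewrite (@coprime_pexpl 2 2) // coprime2n.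
have n4 : (0 < 4 * n)%N by lia.
have z1 := prim_expr_order (zeta_prim R n4).
have : gauss (4 * n) (zeta R (4 * n)) =
    2 * ((1 + 'i ^+ n) * gauss n (zeta R n)).
  rewrite gauss_crt // mulrA; congr (_ * _).
    have -> : zeta R (4 * n) ^+ (n ^ 2) = 'i ^+ n.
      by rewrite expnS expn1 exprM mulnC zeta_mul // zeta4.
    rewrite /gauss !big_ord_recl big_ord0 /= /bump /= !expr0 expr1.
    have i4 : 'i ^+ 4 = 1 :> R[i] := exprI4 R 1 0.
    rewrite -!exprM.
    have -> : 'i ^+ (n * 2 ^ 2) = 1 :> R[i] by rewrite mulnC exprM i4 expr1n.
    have -> : 'i ^+ (n * 3 ^ 2) = 'i ^+ n :> R[i].
      have -> : (n * 3 ^ 2 = 4 * (2 * n) + n)%N by lia.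
      by rewrite exprD exprM i4 expr1n mul1r.
    ring.
  have -> : zeta R (4 * n) ^+ (4 ^ 2) = zeta R n ^+ (1 * 2 ^ 2).
    by rewrite (_ : 4 ^ 2 = 4 * 4)%N // exprM zeta_mul.
  rewrite gauss_mul_sqr ?expr1 // ?coprime2n //.
  exact: prim_expr_order (zeta_prim R n0).
rewrite gauss_4k // natrM sqrtrM // rmorphM /=.
have -> : Num.sqrt 4 = 2 :> R.
  by rewrite -[X in Num.sqrt X](_ : 2 ^+ 2 = 4) ?sqrtr_sqr ?ger0_norm // -natrX.
rewrite mulrCA rmorph_nat => /mulfI <- //.
by rewrite pnatr_eq0.
Qed.

(** G(1; 4Kr) = G(r; 4K) G(4K; r), and the last factor is the Jacobi symbol times G(1; r). *)
Lemma gauss_4k_jacobi (R : realType) (K r : nat) : (0 < K)%N ->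
  coprime r (4 * K) ->
  (jacobi (4 * K) r)%:~R * gauss (4 * K) (zeta R (4 * K) ^+ r) =
  (1 + 'i ^+ r) * (Num.sqrt (4 * K)%:R)%:C.
Proof.
move=> K0 rn; set n := (4 * K)%N in rn *.
have ro : odd r.
  have := coprime_dvdr (dvdn_mulr K (dvdnn 4)) rn.
  by rewrite (@coprime_pexpr 2 r 2) // coprimen2.
have r0 : (0 < r)%N by case: (r) ro.
have n0 : (0 < n)%N by rewrite muln_gt0.
have nr0 : (0 < n * r)%N by rewrite muln_gt0 n0.
have Kr0 : (0 < K * r)%N by rewrite muln_gt0 K0.
have := gauss_4k R Kr0; rewrite mulnA -/n gauss_crt; last 2 first.
- by rewrite coprime_sym.
- exact: prim_expr_order (zeta_prim R nr0).
have -> : zeta R (n * r) ^+ (r ^ 2) = zeta R n ^+ r.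
  by rewrite expnS expn1 exprM mulnC zeta_mul.
have -> : zeta R (n * r) ^+ (n ^ 2) = zeta R r ^+ n.
  by rewrite expnS expn1 exprM zeta_mul.
rewrite (gauss_jacobi ro (zeta_prim R r0)) 1?coprime_sym //.
(* Multiplying by 1 + i^r produces the left side of [gauss_odd] for r; then (1 + i) sqrt r
   cancels. *)
move=> /(congr1 (fun u => (1 + 'i ^+ r) * u)).
rewrite natrM sqrtrM // rmorphM /= => H.
have i1 : (1 + 'i) * (Num.sqrt r%:R)%:C != 0 :> R[i].
  rewrite mulf_neq0 //; last first.
    by rewrite eq_complex /= eqxx andbT sqrtr_eq0 -ltNge ltr0n.
  by rewrite eq_complex /= addr0 oner_eq0.
apply: (mulIf i1); rewrite -{1}gauss_odd //.
transitivity ((1 + 'i ^+ r) *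
  (gauss n (zeta R n ^+ r) * ((jacobi n r)%:~R * gauss r (zeta R r)))).
  by ring.
by rewrite H; ring.
Qed.

(** Shifting j by n/2 = 2k + 1 negates every term, since r and 2k + 1 are odd and z^(n/2) = -1; so
    the sum equals its opposite. *)
Lemma gauss_4k2 (R : realType) (k r : nat) : odd r ->
  gauss (4 * k + 2) (zeta R (4 * k + 2) ^+ r) = 0.
Proof.
move=> ro; set n := (4 * k + 2)%N; have n0 : (0 < n)%N by lia.
have zp := zeta_prim R n0; have z1 := prim_expr_order zp.
have zn : zeta R n ^+ (2 * k + 1) = -1.
  rewrite zetaX; have -> : 2 * pi * (2 * k + 1)%:R / n%:R = pi :> R.
    have -> : n%:R = 2 * (2 * k + 1)%:R :> R by rewrite -natrM; congr _%:R; lia.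
    have : (2 * k + 1)%:R != 0 :> R by rewrite pnatr_eq0; lia.
    by move: (_%:R) => u u0; field.
  by apply/eqP; rewrite /cis cospi sinpi eq_complex /= oppr0 !eqxx.
have : gauss n (zeta R n ^+ r) = - gauss n (zeta R n ^+ r).
  rewrite {1}/gauss -(@sum_residues _ n (fun x => (zeta R n ^+ r) ^+ (x ^ 2))
    (fun j => j + (2 * k + 1))%N).
  - rewrite /gauss -sumrN; apply: eq_bigr => j _.
    rewrite -!exprM.
    have -> : (r * (j + (2 * k + 1)) ^ 2 =
        r * j ^ 2 + n * (r * j) + (2 * k + 1) * (r * (2 * k + 1)))%N.
      by rewrite /n; ring.
    rewrite 2!exprD (exprM _ n) z1 expr1n mulr1 [X in _ * X]exprM zn.
    by rewrite -signr_odd oddM ro addn1 /= oddM /= expr1 mulrN1.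
  - by move=> x; rewrite -!exprM; apply: (expr_eqmod z1); rewrite -modnMmr modnXm modnMmr.
  - by move=> i j /eqP; rewrite eqn_modDr => /eqP.
by move/eqP; rewrite -addr_eq0 -mulr2n mulrn_eq0 /= => /eqP.
Qed.

(** * Eigenvalue multiplicities *)

Lemma char_poly_similar (F : fieldType) (n : nat) (P A B : 'M[F]_n) :
  P \in unitmx -> P *m A = B *m P -> char_poly A = char_poly B.
Proof.
move=> Pu PA; have Pd : \det (map_mx polyC P) != 0.
  by rewrite det_map_mx polyC_eq0 -unitfE -unitmxE.
apply: (mulfI Pd); rewrite -det_mulmx mulrC -det_mulmx.
congr (\det _).
by rewrite mulmxBr mulmxBl -!map_mxM PA scalar_mxC.
Qed.

Lemma root4_uniq (R : rcfType) : uniq [:: 1; -1; 'i; - 'i : R[i]].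
Proof.
have N1 : (1 == -1 :> R) = false.
  by apply/negbTE; rewrite -subr_eq0 opprK -mulr2n pnatr_eq0.
rewrite /= !inE !eq_complex /= !oppr0 !eqxx N1 oner_eq0 (eq_sym 0 1) oner_eq0.
by rewrite oppr_eq0 oner_eq0 (eq_sym 0 (-1)) oppr_eq0 oner_eq0.
Qed.

(** The minimal polynomial divides X^4 - 1, which splits with simple roots. Hence A is
    diagonalizable, multiplicities count diagonal entries, and traces are power sums. *)
Lemma diagonalize_root4 (R : rcfType) (n : nat) (A : 'M[R[i]]_n.+1) :
  A ^+ 4 = 1 ->
  exists d : 'rV[R[i]]_n.+1,
  [/\ forall x, eigen_mult A x = #|[pred i | d 0 i == x]|,
      forall i, d 0 i \in [:: 1; -1; 'i; - 'i],
      \tr A = \sum_i d 0 i & \tr (A ^+ 2) = \sum_i d 0 i ^+ 2].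
Proof.
move=> A4; pose rs : seq R[i] := [:: 1; -1; 'i; - 'i].
have rsE : \prod_(x <- rs) ('X - x%:P) = 'X^4 - 1 :> {poly R[i]}.
  rewrite !big_cons big_nil !polyCN opprK.
  have i2 : ('i%:P : {poly R[i]}) ^+ 2 = -1 by rewrite -polyC_exp sqr_i polyCN.
  transitivity (('X^2 - 1) * ('X^2 - 'i%:P ^+ 2) : {poly R[i]}); first by ring.
  by rewrite i2; ring.
have rsu : uniq rs := root4_uniq R.
have [P Pu /diagonalizable_forPex[d /(simmxP Pu) PA]] : diagonalizable A.
  apply/diagonalizableP; exists rs => //; rewrite rsE.
  by apply: mxminpoly_min; rewrite rmorphB rmorphXn rmorph1 /= horner_mx_X A4 subrr.
have PAk k : P *m A ^+ k = (diag_mx d) ^+ k *m P.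
  elim: k => [|k IH]; first by rewrite !expr0 mul1mx mulmx1.
  by rewrite !exprSr -!mulmxE mulmxA IH -mulmxA PA mulmxA.
have dk k i j : ((diag_mx d) ^+ k) i j = d 0 i ^+ k *+ (i == j).
  elim: k i j => [|k IH] i j; first by rewrite !expr0 mxE.
  by rewrite exprSr -mulmxE mul_mx_diag mxE IH exprSr mulrnAl; case: eqP => [->|].
have trE k : \tr (A ^+ k) = \sum_i d 0 i ^+ k.
  have -> : A ^+ k = invmx P *m (diag_mx d ^+ k *m P) by rewrite -PAk mulKmx.
  rewrite mxtrace_mulC -mulmxA mulmxV // mulmx1.
  by apply: eq_bigr => i _; rewrite dk eqxx.
exists d; split; last by rewrite trE.
- move=> x; rewrite /eigen_mult (char_poly_similar Pu PA).
  rewrite char_poly_trig ?diag_mx_is_trig //.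
  under eq_bigr do rewrite mxE eqxx mulr1n.
  rewrite -(big_map (fun i => d 0 i) xpredT (fun y => 'X - y%:P)) mu_prod_XsubC.
  by rewrite count_map -sum1_count sum1_card.
- move=> i; rewrite -root_prod_XsubC rsE /root !hornerE; apply/eqP.
  have := PAk 4; rewrite A4 mulmx1 -{1}[P]mul1mx => /(can_inj (mulmxK Pu)).
  by move/matrixP/(_ i i); rewrite dk !mxE eqxx !mulr1n => <-; rewrite subrr.
by rewrite -[A]expr1 trE.
Qed.

(** Grouping the diagonal entries by value gives the dimension and both traces: four real linear
    equations for four multiplicities. *)
Lemma eigen_mults_root4 (R : rcfType) (n : nat) (A : 'M[R[i]]_n.+1) :
  A ^+ 4 = 1 ->
  let t x := eigen_mult A x in
  [/\ n.+1 = (t 1%R + t (- 1)%R + t 'i%C + t (- 'i%C)%R)%N,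
      \tr A = ((t 1)%:R - (t (-1))%:R) +i* ((t 'i%C)%:R - (t (- 'i%C))%:R) &
      \tr (A ^+ 2) = ((t 1)%:R + (t (-1))%:R - (t 'i%C)%:R - (t (- 'i%C))%:R)%:C].
Proof.
move=> A4 t; have [d [tE dE tr1 tr2]] := diagonalize_root4 A4.
have {tE} : forall x, t x = #|[pred i | d 0 i == x]| := tE.
move: t => /= t tE; pose rs : seq R[i] := [:: 1; -1; 'i; - 'i].
have rsu : uniq rs := root4_uniq R.
(* Multiples are rewritten as products with explicit complex numbers, so that [simpc] can separate
   real and imaginary parts. *)
have natC (x : R[i]) k : x *+ k = x * (k%:R +i* 0).
  transitivity (x * k%:R); first by rewrite mulr_natr.
  by congr (_ * _); rewrite -(rmorph_nat (real_complex R)).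
have sumE (V : nmodType) (g : R[i] -> V) : \sum_i g (d 0 i) = \sum_(x <- rs) g x *+ t x.
  rewrite [RHS](eq_bigr (fun x => \sum_(i | d 0 i == x) g x)) => [|x _]; last first.
      by rewrite tE sumr_const.
  rewrite (exchange_big_dep xpredT) //=; apply: eq_bigr => i _.
  under eq_bigl => x do rewrite eq_sym.
  rewrite (big_rem (d 0 i)) ?dE // eqxx big1_seq => [|x /andP[/eqP ->]].
    by rewrite /= addr0.
  by rewrite mem_rem_uniq // inE eqxx.
split.
- have natE k : (1%N : nat) *+ k = k := natn k.
  have := sumE nat (fun=> 1%N); rewrite sum1_card card_ord => ->.
  rewrite !big_cons big_nil.
  transitivity (t 1%R + (t (- 1)%R + (t 'i%C + (t (- 'i%C)%R + 0))))%N; last first.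
    by rewrite addn0 !addnA.
  by rewrite !natE.
- rewrite tr1 (sumE _ id) !big_cons big_nil addr0 !natC; simpc.
  by [].
rewrite tr2 (sumE _ (fun x => x ^+ 2)) !big_cons big_nil addr0 !natC.
rewrite !sqrrN sqr_i expr1n; simpc.
by congr (_ +i* _); ring.
Qed.

(** * The Fourier matrix with permuted columns *)

Lemma coprime_valZ (n : nat) (m : {unit 'Z_n.+2}) : coprime (val m) n.+2.
Proof.
by have := valP m; rewrite -[X in X \is a _]natr_Zp unitZpE // coprime_sym.
Qed.

Lemma fourier_mul_mxE (R : realType) (n : nat) (m : {unit 'Z_n.+2}) j k :
  fourier_mul_mx R m j k =
    (Num.sqrt n.+2%:R)^-1%:C * zeta R n.+2 ^+ (val m * (j * k)).
Proof.
rewrite /fourier_mul_mx mxE (bigD1 (mulZ_perm m k)) //= big1 => [|l lk].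
  rewrite !mxE eqxx mulr1 addr0 -zetaX; congr (_ * _).
  apply: (expr_eqmod (prim_expr_order (zeta_prim R (ltn0Sn n.+1)))).
  by rewrite permE /= modnMmr mulnCA.
by rewrite !mxE eq_sym (negPf lk) mulr0.
Qed.

(** The entry is the mean over k of z^(m(i+j)k); orthogonality applies, and the unit m does not
    affect divisibility by the modulus. *)
Lemma fourier_mul_mx_sqr (R : realType) (n : nat) (m : {unit 'Z_n.+2}) i j :
  (fourier_mul_mx R m ^+ 2) i j = (n.+2 %| i + j)%N%:R.
Proof.
have zp := zeta_prim R (ltn0Sn n.+1).
rewrite expr2 -mulmxE mxE.
transitivity ((n.+2%:R)^-1 * \sum_(k < n.+2) zeta R n.+2 ^+ (val m * (i + j) * k)).
  rewrite big_distrr /=; apply: eq_bigr => k _.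
  rewrite !fourier_mul_mxE mulrACA -exprD -rmorphM /= -invfM -expr2 sqr_sqrtr //.
  congr (_ * _ ^+ _); last by ring.
  by rewrite fmorphV rmorph_nat.
rewrite (sum_expr_prim _ zp) Gauss_dvdr 1?coprime_sym ?coprime_valZ //.
by case: ifP => _; rewrite ?mulr0 // mulVf // pnatr_eq0.
Qed.

Lemma fourier_mul_mx_root4 (R : realType) (n : nat) (m : {unit 'Z_n.+2}) :
  fourier_mul_mx R m ^+ 4 = 1.
Proof.
have dE (i j : 'Z_n.+2) : (n.+2 %| i + j)%N = (j == - i).
  by rewrite -addr_eq0 addrC -val_eqE.
apply/matrixP => i j; rewrite (exprM _ 2 2) (expr2 (_ ^+ 2)) -mulmxE mxE.
rewrite (bigD1 (- i : 'Z_n.+2)) //= big1 => [|k ki].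
  rewrite !fourier_mul_mx_sqr !dE eqxx opprK mul1r addr0.
  by rewrite mxE eq_sym.
by rewrite fourier_mul_mx_sqr dE (negPf ki) mul0r.
Qed.

Lemma fourier_mul_mx_trace (R : realType) (n : nat) (m : {unit 'Z_n.+2}) :
  (Num.sqrt n.+2%:R)%:C * \tr (fourier_mul_mx R m) =
  gauss n.+2 (zeta R n.+2 ^+ val m).
Proof.
rewrite /mxtrace /gauss big_distrr /=; apply: eq_bigr => j _.
rewrite fourier_mul_mxE mulrA -rmorphM mulfV; last by rewrite sqrtr_eq0 -ltNge ltr0n.
by rewrite mul1r -exprM mulnn.
Qed.

(** The trace counts the fixed points of negation: 0, and half the modulus when that is even. *)
Lemma fourier_mul_mx_sqr_trace (R : realType) (n : nat) (m : {unit 'Z_n.+2}) :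
  \tr (fourier_mul_mx R m ^+ 2) = (~~ odd n).+1%:R.
Proof.
rewrite /mxtrace; under eq_bigr => j _ do rewrite fourier_mul_mx_sqr.
rewrite -natr_sum; congr _%:R; rewrite big_ord_recl /= add1n; congr _.+1.
rewrite /Zp_trunc /=.
case: (boolP (odd n)) => no.
  rewrite big1 // => i _; rewrite addnn -mul2n Gauss_dvdr ?coprimen2 /= ?no //.
  by rewrite gtnNdvd // ltnS.
(* With the index 0 removed, i stands for the residue i + 1, so half of n + 2 is found at i =
   [n./2]. *)
have hn : (n./2 < n.+1)%N by lia.
rewrite (bigD1 (Ordinal hn)) //= big1 => [|i]; rewrite /bump /= add1n.
  by rewrite (_ : n./2.+1 + n./2.+1 = n.+2)%N ?dvdnn //; lia.
rewrite -val_eqE /= => ih; have := ltn_ord i => iln.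
case: dvdnP => // -[[|[|e]]] /=; lia.
Qed.

(** The linear system for the multiplicities has only one solution, so it is enough to check that
    the proposed values satisfy it. *)
Lemma fourier_mul_mx_mults (R : realType) (n : nat) (m : {unit 'Z_n.+2})
    (a b : int) (t1 tN1 ti tNi : nat) :
  let M := fourier_mul_mx R m in
  \tr M = a%:~R +i* b%:~R ->
  (t1 + tN1 + ti + tNi = n.+2)%N -> t1%:Z - tN1%:Z = a -> ti%:Z - tNi%:Z = b ->
  (t1 + tN1 = ti + tNi + (~~ odd n).+1)%N ->
  eigen_mults M = (t1, tN1, ti, tNi).
Proof.
move=> M trM En Ea Eb E2; rewrite /eigen_mults.
have [] := eigen_mults_root4 (fourier_mul_mx_root4 R m); rewrite -/M trM.
rewrite fourier_mul_mx_sqr_trace.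
move: (eigen_mult M 1) (eigen_mult M (-1)) (eigen_mult M 'i%C) (eigen_mult M (- 'i%C)).
move=> u1 uN1 ui uNi /= Fn [Fa Fb] F2.
have {}Fa : a = u1%:Z - uN1%:Z by apply: (@intr_inj R); rewrite Fa rmorphB.
have {}Fb : b = ui%:Z - uNi%:Z by apply: (@intr_inj R); rewrite Fb rmorphB.
have {}F2 : ((~~ odd n).+1 : int) = u1%:Z + uN1%:Z - ui%:Z - uNi%:Z.
  apply: (@intr_inj R[i]); rewrite !rmorphB rmorphD /= -!pmulrn F2.
  by rewrite !rmorphB rmorphD /= !rmorph_nat.
by rewrite /Zp_trunc /= in Fn; congr (_, _, _, _); lia.
Qed.

Lemma fourier_mul_mx_trace_4k (R : realType) (n k : nat) (m : {unit 'Z_n.+2}) :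
  n.+2 = (4 * k)%N ->
  (jacobi n.+2 (val m))%:~R * \tr (fourier_mul_mx R m) = 1 + 'i%C ^+ val m.
Proof.
move=> nk; have k0 : (0 < k)%N by lia.
have s0 : (Num.sqrt n.+2%:R)%:C != 0 :> R[i].
  by rewrite fmorph_eq0 sqrtr_eq0 -ltNge ltr0n.
have cm : coprime (val m) (4 * k) by rewrite -nk coprime_valZ.
have := gauss_4k_jacobi R k0 cm; rewrite -nk -fourier_mul_mx_trace mulrCA mulrC.
by move/(mulIf s0).
Qed.

Lemma fourier_mul_mx_trace_odd (R : realType) (n : nat) (m : {unit 'Z_n.+2}) :
  odd n ->
  (1 + 'i%C ^+ n.+2) * \tr (fourier_mul_mx R m) =
  (jacobi (val m) n.+2)%:~R * (1 + 'i%C).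
Proof.
move=> no; have no2 : odd n.+2 by rewrite /= negbK.
have s0 : (Num.sqrt n.+2%:R)%:C != 0 :> R[i].
  by rewrite fmorph_eq0 sqrtr_eq0 -ltNge ltr0n.
apply: (mulfI s0); rewrite mulrCA fourier_mul_mx_trace.
rewrite (gauss_jacobi no2 (zeta_prim R (ltn0Sn _)) (coprime_valZ m)).
by rewrite mulrCA gauss_odd // mulrA mulrC.
Qed.

Lemma fourier_mul_mx_trace_4k2 (R : realType) (n k : nat) (m : {unit 'Z_n.+2}) :
  n.+2 = (4 * k + 2)%N -> \tr (fourier_mul_mx R m) = 0.
Proof.
move=> nk; have s0 : (Num.sqrt n.+2%:R)%:C != 0 :> R[i].
  by rewrite fmorph_eq0 sqrtr_eq0 -ltNge ltr0n.
have mo : odd (val m).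
  rewrite -coprimen2; apply: coprime_dvdr (coprime_valZ m).
  by rewrite nk; lia.
apply: (mulfI s0); rewrite fourier_mul_mx_trace mulr0.
have := gauss_4k2 R k mo; rewrite -nk; exact: id.
Qed.

Theorem theorem5 (R : realType) (n : nat) (m : {unit 'Z_n})
    (hn : (1 < n)%N) (hm : val m != 1) :
  let M := fourier_mul_mx R m in
  let r : nat := val m in
  (forall k l : nat, n = (4 * k)%N -> r = (4 * l + 1)%N -> jacobi n r = 1 ->
     \tr M = 1 + 'i%C /\ eigen_mults M = (k + 1, k, k, k - 1)%N) /\
  (forall k l : nat, n = (4 * k)%N -> r = (4 * l + 1)%N -> jacobi n r = - 1 ->
     \tr M = - 1 - 'i%C /\ eigen_mults M = (k, k + 1, k - 1, k)%N) /\
  (forall k l : nat, n = (4 * k)%N -> r = (4 * l + 3)%N -> jacobi n r = 1 ->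
     \tr M = 1 - 'i%C /\ eigen_mults M = (k + 1, k, k - 1, k)%N) /\
  (forall k l : nat, n = (4 * k)%N -> r = (4 * l + 3)%N -> jacobi n r = - 1 ->
     \tr M = - 1 + 'i%C /\ eigen_mults M = (k, k + 1, k, k - 1)%N) /\
  (forall k : nat, n = (4 * k + 1)%N -> jacobi r n = 1 ->
     \tr M = 1 /\ eigen_mults M = (k + 1, k, k, k)%N) /\
  (forall k : nat, n = (4 * k + 1)%N -> jacobi r n = - 1 ->
     \tr M = - 1 /\ eigen_mults M = (k, k + 1, k, k)%N) /\
  (forall k : nat, n = (4 * k + 2)%N ->
     \tr M = 0 /\ eigen_mults M = (k + 1, k + 1, k, k)%N) /\
  (forall k : nat, n = (4 * k + 3)%N -> jacobi r n = 1 ->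
     \tr M = 'i%C /\ eigen_mults M = (k + 1, k + 1, k + 1, k)%N) /\
  (forall k : nat, n = (4 * k + 3)%N -> jacobi r n = - 1 ->
     \tr M = - 'i%C /\ eigen_mults M = (k + 1, k + 1, k, k + 1)%N).
Proof.
case: n m hn hm => [//|[//|n]] m _ _ M r.
have i3 : 'i ^+ 3 = - 'i :> R[i] by rewrite exprS sqr_i mulrN1.
have close (a b : int) (z : R[i]) (t1 tN1 ti tNi : nat) :
    \tr M = z -> z = a%:~R +i* b%:~R ->
    (t1 + tN1 + ti + tNi = n.+2)%N -> t1%:Z - tN1%:Z = a -> ti%:Z - tNi%:Z = b ->
    (t1 + tN1 = ti + tNi + (~~ odd n).+1)%N ->
    \tr M = z /\ eigen_mults M = (t1, tN1, ti, tNi).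
  move=> trM zE En Ea Eb E2; split=> //.
  by apply: (@fourier_mul_mx_mults R n m a b); rewrite -?zE.
have tr1 k : n.+2 = (4 * k + 1)%N -> \tr M = (jacobi r n.+2)%:~R.
  move=> nk; have no : odd n by lia.
  have := fourier_mul_mx_trace_odd R m no.
  rewrite [X in 'i ^+ X]nk exprI4 expr1 mulrC => /mulIf; apply.
  by rewrite eq_complex /= addr0 oner_eq0.
(* Here i^n = -i, and 1 + i = i (1 - i) lets the factor 1 - i cancel. *)
have tr3 k : n.+2 = (4 * k + 3)%N -> \tr M = (jacobi r n.+2)%:~R * 'i.
  move=> nk; have no : odd n by lia.
  have := fourier_mul_mx_trace_odd R m no.
  have -> : 1 + 'i = 'i * (1 - 'i) :> R[i].
    by rewrite mulrBr -expr2 sqr_i mulr1 opprK addrC.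
  rewrite [X in 'i ^+ X]nk exprI4 i3 mulrA mulrC => /mulIf; apply.
  by rewrite eq_complex /= subr0 oner_eq0.
refine (conj _ (conj _ (conj _ (conj _ (conj _ (conj _ (conj _ (conj _ _)))))))) => k.
(* In the four cases with modulus 4k, [nk] forces k > 0, so the truncated [k - 1] is a true
   difference. *)
- move=> l nk rl J; have := fourier_mul_mx_trace_4k R m nk.
  rewrite -/r J rl exprI4 mul1r expr1 => trM.
  by apply: (close 1 1) => //; [simpc | lia..].
- move=> l nk rl J; have := fourier_mul_mx_trace_4k R m nk.
  rewrite -/r J rl exprI4 mulrN1z mulN1r expr1 => /(canRL opprK); rewrite opprD => trM.
  by apply: (close (-1) (-1)) => //; [simpc | lia..].
- move=> l nk rl J; have := fourier_mul_mx_trace_4k R m nk.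
  rewrite -/r J rl exprI4 mul1r i3 => trM.
  by apply: (close 1 (-1)) => //; [simpc | lia..].
- move=> l nk rl J; have := fourier_mul_mx_trace_4k R m nk.
  rewrite -/r J rl exprI4 mulrN1z mulN1r i3 => /(canRL opprK); rewrite opprB addrC => trM.
  by apply: (close (-1) 1) => //; [simpc | lia..].
- move=> nk J; have := tr1 _ nk; rewrite J => trM.
  by apply: (close 1 0) => //; lia.
- move=> nk J; have := tr1 _ nk; rewrite J mulrN1z => trM.
  by apply: (close (-1) 0) => //; [simpc | lia..].
- move=> nk; have trM := fourier_mul_mx_trace_4k2 R m nk.
  by apply: (close 0 0) => //; lia.
- move=> nk J; have := tr3 _ nk; rewrite J mul1r => trM.
  by apply: (close 0 1) => //; lia.
move=> nk J; have := tr3 _ nk; rewrite J mulrN1z mulN1r => trM.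
by apply: (close 0 (-1)) => //; [simpc | lia..].
Qed.
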